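(* Fix $c\in\mathbb{C}$ and let $X\subset (c\cdot\mathbf 1)+c_0$ be nonempty, locally box-open, permutation-invariant, and $c_{00}$-chain-connected, where $\mathbf 1=(1,1,\ldots)$. Let $f:X\to\mathbb{C}$ be admissibly holomorphic with bounded differential, and invariant under all finite permutations, i.e. $f(x\circ\sigma)=f(x)$ for all $x\in X$ and $\sigma\in S_{\mathrm{fin}}$. Suppose moreover that $Df(x)[h]=0$ for all $x\in X$ and all $h\in c_{00}$. Then $f$ is constant on $X$.
   Context: Let $\ell^\infty$ be the space of bounded complex sequences indexed by $\mathbb{N}$ with norm $\|\cdot\|_\infty$, $c_0\subset\ell^\infty$ the closed subspace of sequences tending to $0$, and $c_{00}\subset c_0$ the subspace of finitely supported complex sequences. $e_k$ is the sequence with $1$ in position $k$ and $0$ elsewhere. $S_{\mathrm{fin}}$ is the group of bijections $\sigma:\mathbb{N}\to\mathbb{N}$ fixing all but finitely many elements, acting on $\mathbb{C}^{\mathbb{N}}$ by $(x\circ\sigma)_n=x_{\sigma(n)}$. A subset $X\subset\mathbb{C}^{\mathbb{N}}$ is: permutation-invariant if $x\circ\sigma\in X$ for all $x\in X$, $\sigma\in S_{\mathrm{fin}}$; locally box-open if for every $x\in X$ there is $r>0$ with $x+h\in X$ for all $h\in c_{00}$ with $\|h\|_\infty<r$; $c_{00}$-chain-connected if for any $x,y\in X$ there is a finite sequence $x=z_0,z_1,\ldots,z_m=y$ in $X$ with $z_{\ell+1}-z_\ell\in c_{00}$ and $\{z_\ell+t(z_{\ell+1}-z_\ell):t\in[0,1]\}\subset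 X$ for each $\ell$. A function $f:X\to\mathbb{C}$ on a locally box-open, permutation-invariant set $X\subset\mathbb{C}^{\mathbb{N}}$ is admissibly holomorphic if it carries a differential datum $x\mapsto Df(x)$, where each $Df(x):c_{00}\to\mathbb{C}$ is $\mathbb{C}$-linear, such that: (i) for every $x\in X$ and $k\in\mathbb{N}$, the map $\varepsilon\mapsto f(x+\varepsilon e_k)$ is holomorphic in a neighborhood of $0\in\mathbb{C}$; (ii) for every $x\in X$ there is a constant $C_x$ with $|Df(x)[h]|\le C_x\|h\|_\infty$ for all $h\in c_{00}$ (this is what ''bounded differential'' means), and $f(x+h)=f(x)+Df(x)[h]+o(\|h\|_\infty)$ as $h\to0$ in $c_{00}$ (with respect to $\|\cdot\|_\infty$). *)

(* Defs.v *)
From HB Require Import structures.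
From mathcomp Require Import all_boot all_order all_algebra.
From mathcomp Require Import all_classical all_reals all_analysis.
From mathcomp Require Export complex.

Set Implicit Arguments.
Unset Strict Implicit.
Unset Printing Implicit Defensive.

Import Order.TTheory GRing.Theory Num.Theory numFieldNormedType.Exports.
Import Normc.

Local Open Scope classical_set_scope.
Local Open Scope complex_scope.
Local Open Scope ring_scope.

(* The complex field over an arbitrary [R : realType].  The regular module
   [(R[i])^o] carries the topology, the normed-module structure over [R[i]] and,
   for functions into it, pointwise scaling; [R[i]] itself does not.
   The library norm [`|z|] is valued in [R[i]], whereas [normc z : R] is the
   modulus as a real number. *)
Notation CC R := ((R[i])^o).
Notation cseq R := (nat -> CC R).

Section Sequences.
Variable R : realType.
Implicit Types x h : cseq R.

Definition c0 : set (cseq R) := [set x | x @ \oo --> (0 : CC R)].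

Definition c00 : set (cseq R) := [set x | finite_set [set n | x n != 0]].

(* Meaningful for bounded sequences only ([sup] is [0] on unbounded sets). *)
Definition sup_norm x : R := sup [set normc (x n) | n in [set: nat]].

Definition unit_seq (k : nat) : cseq R := fun n => (n == k)%:R.

Definition Sfin : set (nat -> nat) :=
  [set s : nat -> nat | bijective s /\ finite_set [set n | s n != n]].

End Sequences.

Arguments c0 : clear implicits.
Arguments c00 : clear implicits.
Arguments unit_seq : clear implicits.

Section Sets.
Variables (R : realType) (X : set (cseq R)).

Definition permutation_invariant : Prop :=
  forall x s, X x -> Sfin s -> X (x \o s).

Definition locally_box_open : Prop := forall x, X x ->
  exists2 r : R, 0 < r & forall h, c00 R h -> sup_norm h < r -> X (x + h).

Definition c00_chain_connected : Prop := forall x y, X x -> X y ->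
  exists (m : nat) (z : nat -> cseq R),
    [/\ z 0%N = x, z m = y,
        forall l, (l <= m)%N -> X (z l) &
        forall l, (l < m)%N ->
          c00 R (z l.+1 - z l) /\
          forall t : R, 0 <= t <= 1 -> X (z l + t%:C *: (z l.+1 - z l))].

End Sets.

Section Holomorphy.
Variable R : realType.

Definition holomorphic_near (g : CC R -> CC R) (a : CC R) : Prop :=
  \forall w \near a, derivable g w 1.

(* A function on [X] is represented by a total function of which only the
   values on [X] matter; similarly, only [Df x h] with [x] in [X] and [h] in
   [c00] matters.  This reads clauses two and four correctly because [X] is
   meant to be locally box-open: [x + h] and [x + w *: unit_seq R k] then belong
   to [X] for all small [h] and [w]. *)
Definition admissibly_holomorphic (X : set (cseq R)) (f : cseq R -> CC R)
    (Df : cseq R -> cseq R -> CC R) : Prop :=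
  [/\ forall x, X x -> forall (a : R[i]) h k, c00 R h -> c00 R k ->
        Df x (a *: h + k) = a *: Df x h + Df x k,
      forall x k, X x ->
        holomorphic_near (fun w : CC R => f (x + w *: unit_seq R k)) 0,
      forall x, X x -> exists M : R, forall h, c00 R h ->
        normc (Df x h) <= M * sup_norm h &
      forall x, X x -> forall eps : R, 0 < eps ->
        exists2 delta : R, 0 < delta &
          forall h, c00 R h -> sup_norm h < delta ->
            normc (f (x + h) - f x - Df x h) <= eps * sup_norm h].

End Holomorphy.

(* Main.v *)
(* On each segment [z + t (w - z)] of a chain the vanishing differential makes
   [f] a function of the real variable [t] with derivative zero, so [f] takes the
   same value at both ends by the mean value theorem applied to the real and
   imaginary parts. *)

Require Import Defs.
From mathcomp Require Import all_boot all_order all_algebra.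
From mathcomp Require Import all_classical all_reals all_analysis.

Set Implicit Arguments.
Unset Strict Implicit.
Unset Printing Implicit Defensive.

Import Order.TTheory GRing.Theory Num.Theory numFieldNormedType.Exports.
Import Normc.

Local Open Scope classical_set_scope.
Local Open Scope complex_scope.
Local Open Scope ring_scope.

(** Dividing by [s] turns the estimate into a zero derivative at every point of the closed interval,
    with [delta] free to depend on [t]. Since [s] takes both signs even at [t = 0] and [t = 1], the
    derivative is two-sided there and gives the continuity up to the endpoints that the mean value
    theorem asks for. *)
Lemma const_of_pointwise_littleo (R : realType) (phi : R -> R) :
  (forall t : R, 0 <= t <= 1 -> forall eps : R, 0 < eps ->
    exists2 delta : R, 0 < delta &
      forall s : R, `|s| < delta -> `|phi (t + s) - phi t| <= eps * `|s|) ->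
  phi 1 = phi 0.
Proof.
move=> phi_o.
have phi'0 (t : R) : t \in `[0, 1] -> is_derive t 1 phi 0.
  rewrite in_itv /= => /phi_o{}phi_o.
  have phi'_cvg :
      (fun s : R => s^-1 *: ((phi \o shift t) (s *: (1 : R)) - phi t))
        @ 0^' --> (0 : R).
    apply/cvgrPdist_le => /= eps /phi_o[delta delta_gt0 phi_delta].
    near=> s.
    have s_neq0 : s != 0 by near: s; exact: nbhs_dnbhs_neq.
    rewrite sub0r normrN normrZ normfV ler_pdivrMl ?normr_gt0//.
    rewrite [s *: 1]mulr1 [s + t]addrC [`|s| * _]mulrC; apply: phi_delta.
    near: s; exact: dnbhs0_lt.
  by apply: DeriveDef; [apply/cvg_ex; exists 0 | exact: cvg_lim].
have phi_within : {within `[0, 1], continuous phi}.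
  by apply: derivable_within_continuous => t /phi'0[].
have phi'0_oo (t : R) : t \in `]0, 1[ -> is_derive t 1 phi ((fun=> 0) t).
  by move=> /subset_itv_oo_cc /phi'0.
have [t _] := MVT_segment (@ler01 R) phi'0_oo phi_within.
by rewrite mul0r => /subr0_eq.
Unshelve. all: by end_near.
Qed.

Lemma ler_Re_normc (R : realType) (z : R[i]) : `|complex.Re z| <= normc z.
Proof. by case: z => a b /=; rewrite -sqrtr_sqr ler_wsqrtr// lerDl sqr_ge0. Qed.

Lemma ler_Im_normc (R : realType) (z : R[i]) : `|complex.Im z| <= normc z.
Proof. by case: z => a b /=; rewrite -sqrtr_sqr ler_wsqrtr// lerDr sqr_ge0. Qed.

Lemma normc_real (R : realType) (s : R) : normc s%:C = `|s|.
Proof. by rewrite /= expr0n addr0 sqrtr_sqr. Qed.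

Lemma normc_ge0 (R : realType) (z : R[i]) : 0 <= normc z.
Proof. by case: z => a b; exact: sqrtr_ge0. Qed.

(** The sum of the moduli over the finite support is a bound. This is what makes [sup_norm h] a
    genuine upper bound of the moduli instead of the default value of [sup]. *)
Lemma c00_has_ubound (R : realType) (h : cseq R) :
  c00 R h -> has_ubound [set normc (h n) | n in [set: nat]].
Proof.
move=> /finite_seqP[s supp_s]; exists (\sum_(i <- s) normc (h i)).
move=> _ [n _ <-]; have [hn0|hn0] := eqVneq (h n) 0.
  by rewrite hn0 normc0 sumr_ge0// => i _; exact: normc_ge0.
have ns : n \in s by have : [set n | h n != 0] n by []; rewrite supp_s.
by rewrite (big_rem n ns) /= lerDl sumr_ge0// => i _; exact: normc_ge0.
Qed.

Lemma sup_norm_ge0 (R : realType) (h : cseq R) : c00 R h -> 0 <= sup_norm h.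
Proof.
move=> /c00_has_ubound/ub_le_sup h_le; apply: le_trans (normc_ge0 (h 0%N)) _.
by apply: h_le; exists 0%N.
Qed.

Lemma c00Z (R : realType) (a : R[i]) (h : cseq R) : c00 R h -> c00 R (a *: h).
Proof.
apply: sub_finite_set => n /=; apply: contra_neq => hn0.
by rewrite fctE /= hn0 scaler0.
Qed.

Lemma sup_normZ_le (R : realType) (s : R) (h : cseq R) :
  c00 R h -> sup_norm (s%:C *: h) <= `|s| * sup_norm h.
Proof.
move=> /c00_has_ubound/ub_le_sup h_le; apply: ge_sup.
  by exists (normc ((s%:C *: h) 0%N)); exists 0%N.
move=> _ [n _ <-]; rewrite normcM normc_real ler_wpM2l//.
by apply: h_le; exists n.
Qed.

(** With [h] fixed, an increment [s] of the parameter moves the point by [s%:C *: h], of sup norm at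
    most [|s| * sup_norm h]; an error small relative to the sup norm is therefore small relative to
    [|s|]. *)
Lemma differential0_const_on_segment (R : realType) (X : set (cseq R))
    (f : cseq R -> CC R) (z h : cseq R) :
  (forall x, X x -> forall eps : R, 0 < eps ->
    exists2 delta : R, 0 < delta &
      forall k, c00 R k -> sup_norm k < delta ->
        normc (f (x + k) - f x) <= eps * sup_norm k) ->
  c00 R h -> (forall t : R, 0 <= t <= 1 -> X (z + t%:C *: h)) ->
  f (z + h) = f z.
Proof.
move=> f_o h00 zhX.
pose g (t : R) := f (z + t%:C *: h).
(* The added 1 keeps the divisor positive when [h = 0]. *)
have H_gt0 : 0 < sup_norm h + 1 by rewrite ltr_wpDl// sup_norm_ge0.
(* Only the base point must lie on the segment: [t + s] may leave the unit interval, because the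
   expansion at [z + t%:C *: h] covers all small increments in [c00]. *)
have g_o (t : R) : 0 <= t <= 1 -> forall eps : R, 0 < eps ->
    exists2 delta : R, 0 < delta &
      forall s : R, `|s| < delta -> normc (g (t + s) - g t) <= eps * `|s|.
  move=> /zhX/f_o{}f_o eps eps_gt0.
  have [|delta delta_gt0 f_delta] := f_o (eps / (sup_norm h + 1)).
    exact: divr_gt0.
  exists (delta / (sup_norm h + 1)); first exact: divr_gt0.
  move=> s; rewrite ltr_pdivlMr// => s_lt.
  have sh_le : sup_norm (s%:C *: h) <= `|s| * (sup_norm h + 1).
    by rewrite (le_trans (sup_normZ_le _ h00))// ler_wpM2l// lerDl.
  rewrite /g rmorphD scalerDl addrA.
  apply: le_trans (f_delta _ (c00Z _ h00) (le_lt_trans sh_le s_lt)) _.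
  rewrite mulrAC ler_pdivrMr// -mulrA.
  by rewrite ler_wpM2l// ltW.
(* An additive map dominated by the modulus inherits the estimate; [p] will be the real and then the
   imaginary part. *)
have g_part (p : R[i] -> R) : {morph p : u v / u - v} ->
    (forall u, `|p u| <= normc u) -> p (g 1) = p (g 0).
  move=> pB p_le; apply: (@const_of_pointwise_littleo R (p \o g)).
  move=> t /g_o{}g_o eps /g_o[delta delta_gt0 g_delta]; exists delta => // s.
  by move=> /g_delta; apply: le_trans; rewrite /= -pB.
have : g 1 = g 0.
  apply/eqP; rewrite eq_complex; apply/andP; split; apply/eqP.
    by apply: (g_part (@complex.Re R)) => [[? ?] [? ?]|] //; exact: ler_Re_normc.
  by apply: (g_part (@complex.Im R)) => [[? ?] [? ?]|] //; exact: ler_Im_normc.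
by rewrite /g scale1r scale0r addr0.
Qed.

Theorem theorem4p1 (R : realType) (c : CC R) (X : set (cseq R))
    (f : cseq R -> CC R) (Df : cseq R -> cseq R -> CC R) :
  X `<=` [set cst c + u | u in c0 R] ->
  X !=set0 ->
  locally_box_open X ->
  permutation_invariant X ->
  c00_chain_connected X ->
  admissibly_holomorphic X f Df ->
  (forall x s, X x -> Sfin s -> f (x \o s) = f x) ->
  (forall x h, X x -> c00 R h -> Df x h = 0) ->
  exists a : CC R, forall x, X x -> f x = a.
Proof.
move=> _ [x0 Xx0] _ _ chain [_ _ _ f_diff] _ Df0; exists (f x0) => x Xx.
(* The first-order expansion with its linear term removed by [Df0]. *)
have f_o y : X y -> forall eps : R, 0 < eps ->
    exists2 delta : R, 0 < delta &
      forall k, c00 R k -> sup_norm k < delta ->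
        normc (f (y + k) - f y) <= eps * sup_norm k.
  move=> Xy eps /(f_diff y Xy)[delta delta_gt0 f_delta]; exists delta => // k k00.
  by move=> /(f_delta k k00); rewrite Df0// subr0.
have [m [z [z0 zm zX z_seg]]] := chain x0 x Xx0 Xx.
have fz l : (l <= m)%N -> f (z l) = f x0.
  elim: l => [|l IHl] l_le; first by rewrite z0.
  have [h00 segX] := z_seg l l_le.
  rewrite -(IHl (ltnW l_le)).
  (* The segment lemma is applied at [z l] with increment [z l.+1 - z l], so its far end is
     [z l.+1]. *)
  by rewrite -(differential0_const_on_segment f_o h00 segX) subrKC.
by rewrite -zm fz.
Qed.
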